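(* Let $f_i\in\Gamma_0(\mathbb{R}^{n_i})$, let $A_i$ be a real $m\times n_i$ matrix and $\alpha_i>0$ for $i=1,\dots,s$, and let $\beta>0$. Assume that the problem $$\min\Big\{\sum_{i=1}^s f_i(x_i):\ \sum_{i=1}^s A_ix_i=b,\ x_i\in\mathbb{R}^{n_i}\Big\}\qquad(\star)$$ has at least one solution and that $b\in A\big(\mathrm{ri}(\mathrm{dom}(\sum_{i=1}^s f_i))\big)$. For any $(x^0,y^0),(x^1,y^1)\in\mathbb{R}^n\times\mathbb{R}^m$, let $\{(x^k,y^k)\}_{k\in\mathbb{N}}$ be generated, for $k\ge1$, by $$\begin{cases}\tilde x_j^{k}=2x_j^{k}-x_j^{k-1},\quad j=1,\dots,s,\\ x_j^{k+1}=\mathrm{argmin}\big\{\mathcal{L}(x_1^{k+1},\dots,x_{j-1}^{k+1},x_j,\tilde x_{j+1}^k,\dots,\tilde x_s^k,y^k)+\frac{\beta}{2\alpha_j}\|x_j-x_j^k\|_2^2:\ x_j\in\mathbb{R}^{n_j}\big\},\quad j=1,\dots,s,\\ y^{k+1}=y^k+\beta\big(\sum_{i=1}^sA_ix_i^{k+1}-b\big).\end{cases}$$ If $0<\alpha_i<\dfrac{1}{2\|\widetilde M_2\|_2}$ for all $i=1,\dots,s$, then the sequence $\{x^k\}$ converges to a solution of problem $(\star)$.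
   Context: $s,m,n_1,\dots,n_s$ are positive integers, $n=\sum_i n_i$, $\mathbb{R}^n=\mathbb{R}^{n_1}\times\cdots\times\mathbb{R}^{n_s}$. $\Gamma_0(\mathbb{R}^d)$: proper lower semicontinuous convex functions $\mathbb{R}^d\to\mathbb{R}\cup\{+\infty\}$. $A=[A_1\ \cdots\ A_s]$, $b\in\mathbb{R}^m$. $\sum_i f_i$ denotes $x\mapsto\sum_i f_i(x_i)$ on $\mathbb{R}^n$; $\mathrm{ri}$ is relative interior. Augmented Lagrangian: $\mathcal{L}(x_1,\dots,x_s,y)=\sum_{i=1}^sf_i(x_i)+\frac\beta2\|\sum_{i=1}^sA_ix_i-b\|_2^2+\langle y,\sum_{i=1}^sA_ix_i-b\rangle$. $\widetilde M_2$ is the $(n+m)\times(n+m)$ matrix, partitioned into blocks of sizes $n_1,\dots,n_s,m$, whose $(i,j)$ block is $A_i^\top A_j$ for $1\le i<j\le s$ and whose other blocks are all $0$. $\|\cdot\|_2$ of a matrix is its largest singular value; $\frac10$ is read as $+\infty$.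
   Formalization: In the j-th subproblem the terms f_i(x_i), i≠j, constant in x_j, are dropped from the augmented Lagrangian: kept literally they can be +∞ at the extrapolated points, making the objective identically +∞ and the argmin undefined; where they are finite nothing changes. *)

(* Defs.v *)
From mathcomp Require Import all_boot all_order all_algebra.
From mathcomp Require Import all_classical all_reals all_analysis.

Set Implicit Arguments.
Unset Strict Implicit.
Unset Printing Implicit Defensive.

Import Order.TTheory GRing.Theory Num.Theory numFieldNormedType.Exports.

Local Open Scope classical_set_scope.
Local Open Scope ring_scope.

(* The canonical norm of the library on matrices is the max norm, hence the
   Euclidean inner product and norm below. *)
Definition dot (R : realType) (d : nat) (u v : 'cV[R]_d) : R :=
  \sum_(i < d) u i 0 * v i 0.

Definition norm2 (R : realType) (d : nat) (u : 'cV[R]_d) : R :=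
  Num.sqrt (\sum_(i < d) u i 0 ^+ 2).

(* The singular values of M are the square roots of the eigenvalues of
   M^T *m M. For d > 0 they form a nonempty finite set, whose sup is its
   maximum. *)
Definition singular_values (R : realType) (d : nat) (M : 'M[R]_d) : set R :=
  [set Num.sqrt l | l in [set l | eigenvalue (M^T *m M) l]].

Definition mxnorm2 (R : realType) (d : nat) (M : 'M[R]_d) : R :=
  sup (singular_values M).

(* The bounds on t are strict because 0 * +oo = 0 in \bar R. *)
Definition econvex (R : realType) (d : nat) (f : 'cV[R]_d -> \bar R) : Prop :=
  forall (x y : 'cV[R]_d) (t : R), 0 < t < 1 ->
    (f (t *: x + (1 - t) *: y)%R <= t%:E * f x + (1 - t)%:E * f y)%E.

Definition proper (R : realType) (d : nat) (f : 'cV[R]_d -> \bar R) : Prop :=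
  (forall x, f x <> -oo%E) /\ (exists x, f x <> +oo%E).

Definition Gamma0 (R : realType) (d : nat) : set ('cV[R]_d -> \bar R) :=
  [set f | [/\ proper f, lower_semicontinuous f & econvex f]].
Arguments Gamma0 : clear implicits.

Definition edom (R : realType) (d : nat) (f : 'cV[R]_d -> \bar R) :
    set 'cV[R]_d :=
  [set x | (f x < +oo)%E].

Definition affine_hull (R : realType) (d : nat) (C : set 'cV[R]_d) :
    set 'cV[R]_d :=
  [set x | exists (k : nat) (c : 'I_k -> R) (p : 'I_k -> 'cV[R]_d),
    [/\ forall i, C (p i), \sum_(i < k) c i = 1
      & x = \sum_(i < k) c i *: p i]].

(* Interior of C in the topology induced on its affine hull. *)
Definition relint (R : realType) (d : nat) (C : set 'cV[R]_d) :
    set 'cV[R]_d :=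
  [set x | C x /\ exists2 U, nbhs x U & U `&` affine_hull C `<=` C].

Definition argmin (T : Type) (R : realType) (D : set T) (F : T -> \bar R) :
    set T :=
  [set x | D x /\ forall z, D z -> (F x <= F z)%E].

(* R^n = R^(n_1) x ... x R^(n_s) is 'cV_(\sum_i n i); the i-th block of x is
   submxcol x i, and \mxcol_i v i assembles a vector from its blocks. *)
Definition sepsum (R : realType) (s : nat) (n : 'I_s -> nat)
    (f : forall i, 'cV[R]_(n i) -> \bar R)
    (x : 'cV[R]_(\sum_(i < s) n i)) : \bar R :=
  (\sum_(i < s) f i (submxcol x i))%E.

Definition residual (R : realType) (s m : nat) (n : 'I_s -> nat)
    (A : forall i, 'M[R]_(m, n i)) (b : 'cV[R]_m)
    (x : 'cV[R]_(\sum_(i < s) n i)) : 'cV[R]_m :=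
  \sum_(i < s) A i *m submxcol x i - b.

Definition solutions (R : realType) (s m : nat) (n : 'I_s -> nat)
    (f : forall i, 'cV[R]_(n i) -> \bar R)
    (A : forall i, 'M[R]_(m, n i)) (b : 'cV[R]_m) :
    set 'cV[R]_(\sum_(i < s) n i) :=
  argmin [set x | \sum_(i < s) A i *m submxcol x i = b] (sepsum f).

Definition auglag (R : realType) (s m : nat) (n : 'I_s -> nat)
    (f : forall i, 'cV[R]_(n i) -> \bar R)
    (A : forall i, 'M[R]_(m, n i)) (b : 'cV[R]_m) (beta : R)
    (x : 'cV[R]_(\sum_(i < s) n i)) (y : 'cV[R]_m) : \bar R :=
  (sepsum f x
   + (beta / 2 * norm2 (residual A b x) ^+ 2 + dot y (residual A b x))%:E)%E.

Definition only (R : realType) (s : nat) (n : 'I_s -> nat)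
    (f : forall i, 'cV[R]_(n i) -> \bar R) (j : 'I_s) :
    forall i, 'cV[R]_(n i) -> \bar R :=
  fun i v => if i == j then f i v else 0%E.

Definition splice (R : realType) (s : nat) (n : 'I_s -> nat)
    (x z : 'cV[R]_(\sum_(i < s) n i)) (j : 'I_s) (v : 'cV[R]_(n j)) :
    'cV[R]_(\sum_(i < s) n i) :=
  \mxcol_(i < s)
    @dfwith 'I_s (fun k => 'cV[R]_(n k))
      (fun k => if (k < j)%N then submxcol x k else submxcol z k) j v i.

(* Objective of the j-th subproblem. The terms f i, i != j, of the Lagrangian
   do not depend on the unknown v and are discarded: they are evaluated at
   points, such as extrapolated ones, where they may be +oo, and keeping them
   would then make the objective identically +oo. *)
Definition subobj (R : realType) (s m : nat) (n : 'I_s -> nat)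
    (f : forall i, 'cV[R]_(n i) -> \bar R)
    (A : forall i, 'M[R]_(m, n i)) (b : 'cV[R]_m) (beta : R)
    (alpha : 'I_s -> R) (xk xtilde xnext : 'cV[R]_(\sum_(i < s) n i))
    (y : 'cV[R]_m) (j : 'I_s) (v : 'cV[R]_(n j)) : \bar R :=
  (auglag (only f j) A b beta (splice xnext xtilde v) y
   + (beta / (2 * alpha j) * norm2 (v - submxcol xk j) ^+ 2)%:E)%E.

(* Each objective is proper, lower semicontinuous and strongly convex, so its
   argmin is a singleton and membership determines the next iterate. *)
Definition generated (R : realType) (s m : nat) (n : 'I_s -> nat)
    (f : forall i, 'cV[R]_(n i) -> \bar R)
    (A : forall i, 'M[R]_(m, n i)) (b : 'cV[R]_m) (beta : R)
    (alpha : 'I_s -> R) (x : nat -> 'cV[R]_(\sum_(i < s) n i))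
    (y : nat -> 'cV[R]_m) : Prop :=
  forall k : nat, (1 <= k)%N ->
    let xtilde := 2 *: x k - x k.-1 in
    (forall j : 'I_s,
       argmin setT (subobj f A b beta alpha (x k) xtilde (x k.+1) (y k) (j := j))
         (submxcol (x k.+1) j))
    /\ y k.+1 = y k + beta *: residual A b (x k.+1).

Definition Mtilde2 (R : realType) (s m : nat) (n : 'I_s -> nat)
    (A : forall i, 'M[R]_(m, n i)) : 'M[R]_((\sum_(i < s) n i) + m) :=
  block_mx (\mxblock_(i < s, j < s) (if (i < j)%N then (A i)^T *m A j else 0))
           0 0 0.

(* Main.v *)
Require Import Defs.
From mathcomp Require Import all_boot all_order all_algebra.
From mathcomp Require Import all_classical all_reals all_analysis.
From mathcomp Require Import ring lra.

(** Write U for the strictly upper block triangular part of A^T A, D for the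
    block diagonal matrix of the 1 / alpha_i, and d^k = x^k - x^(k-1). Putting
    the optimality conditions of the s subproblems together and eliminating
    y^k by means of the dual update gives one inclusion for F = sum_i f_i:
<<
  beta (U (d^(k+1) - d^k) - D d^(k+1)) - A^T y^(k+1)  \in  subdiff F (x^(k+1)).
>>
    So the Gauss-Seidel sweep with extrapolated blocks is a forward-reflected
    step: the only coupling left out by the sweep is U x^(k+1), for which the
    sweep uses the reflection 2 U x^k - U x^(k-1).

    Compare this inclusion with a saddle point (p, q): A p = b and - A^T q lies
    in subdiff F (p). Monotonicity of the subdifferential, with e^k = x^k - p,
    shows that
<<
  V_k = <e^k, D e^k> - 2 <e^k, U d^k> + L |d^k|^2 + |y^k - q|^2 / beta^2
>>
    satisfies
    V_(k+1) + (c - 2 L) |d^(k+1)|^2 + |y^(k+1) - y^k|^2 / beta^2 <= V_k and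
    V_k >= (c - L) |e^k|^2 + |y^k - q|^2 / beta^2, where L is the spectral
    norm of U and c a lower bound of all 1 / alpha_i ([lyapunov_step],
    [lyapunov_coercive]). The step size condition says exactly that some such c
    exceeds 2 L. Hence the iterates are bounded and their increments vanish,
    every cluster point is again a saddle point because the subdifferential of a
    lower semicontinuous function has a closed graph ([subgradient_limit]), and
    V_k built on a cluster point (p, q) is nonincreasing with 0 as a cluster
    value, so it tends to 0 and the whole sequence x^k converges
    ([forward_reflected_cvg]).

    Three facts feed this argument. A saddle point exists: this is Lagrange
    duality under the relative interior condition, obtained from a supporting
    hyperplane of the epigraph of the value function ([supporting_functional],
    [lagrange_multiplier]). The bound 2 |<u, U v>| <= L (|u|^2 + |v|^2) comes
    from maximising the Rayleigh quotient ([mxnorm2_operator_bound]). The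
    inclusion above is Fermat's rule for a convex function plus a quadratic
    ([subgradient_of_argmin], [subgradient_of_subobj]). *)

Set Implicit Arguments.
Unset Strict Implicit.
Unset Printing Implicit Defensive.

Import Order.TTheory GRing.Theory Num.Theory numFieldNormedType.Exports.

Local Open Scope classical_set_scope.
Local Open Scope ring_scope.

(** * The Euclidean inner product *)

Lemma dotE (R : realType) d (u v : 'cV[R]_d) : dot u v = (u^T *m v) 0 0.
Proof. by rewrite mxE; apply: eq_bigr => i _; rewrite mxE. Qed.

Lemma dotC (R : realType) d (u v : 'cV[R]_d) : dot u v = dot v u.
Proof. by apply: eq_bigr => i _; rewrite mulrC. Qed.

Lemma dotDl (R : realType) d (u v w : 'cV[R]_d) :
  dot (u + v) w = dot u w + dot v w.
Proof. by rewrite !dotE linearD mulmxDl mxE. Qed.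

Lemma dotZl (R : realType) d a (u w : 'cV[R]_d) : dot (a *: u) w = a * dot u w.
Proof. by rewrite !dotE linearZ -scalemxAl mxE. Qed.

Lemma dotNl (R : realType) d (u w : 'cV[R]_d) : dot (- u) w = - dot u w.
Proof. by rewrite -scaleN1r dotZl mulN1r. Qed.

Lemma dotBl (R : realType) d (u v w : 'cV[R]_d) :
  dot (u - v) w = dot u w - dot v w.
Proof. by rewrite dotDl dotNl. Qed.

Lemma dotDr (R : realType) d (u v w : 'cV[R]_d) :
  dot w (u + v) = dot w u + dot w v.
Proof. by rewrite !(dotC w) dotDl. Qed.

Lemma dotZr (R : realType) d a (u w : 'cV[R]_d) : dot w (a *: u) = a * dot w u.
Proof. by rewrite !(dotC w) dotZl. Qed.

Lemma dotNr (R : realType) d (u w : 'cV[R]_d) : dot w (- u) = - dot w u.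
Proof. by rewrite !(dotC w) dotNl. Qed.

Lemma dotBr (R : realType) d (u v w : 'cV[R]_d) :
  dot w (u - v) = dot w u - dot w v.
Proof. by rewrite !(dotC w) dotBl. Qed.

Lemma dot0l (R : realType) d (u : 'cV[R]_d) : dot 0 u = 0.
Proof. by rewrite -(scale0r 0) dotZl mul0r. Qed.

Lemma dot_ge0 (R : realType) d (u : 'cV[R]_d) : 0 <= dot u u.
Proof. by apply: sumr_ge0 => i _; rewrite -expr2 sqr_ge0. Qed.

Lemma dot_eq0 (R : realType) d (u : 'cV[R]_d) : dot u u = 0 -> u = 0.
Proof.
move=> /eqP; rewrite psumr_eq0; last by move=> i _; rewrite -expr2 sqr_ge0.
move=> /allP u0; apply/colP => i; rewrite mxE.
by have := u0 i (mem_index_enum _); rewrite /= -expr2 sqrf_eq0 => /eqP.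
Qed.

Lemma norm2_sqr (R : realType) d (u : 'cV[R]_d) : norm2 u ^+ 2 = dot u u.
Proof.
by rewrite sqr_sqrtr ?sumr_ge0// => i _; rewrite sqr_ge0.
Qed.

Lemma dot_mulmx (R : realType) d e (M : 'M[R]_(d, e)) (u : 'cV[R]_d) v :
  dot u (M *m v) = dot (M^T *m u) v.
Proof. by rewrite !dotE trmx_mul trmxK mulmxA. Qed.

Lemma sqr_entry_le_dot (R : realType) d (u : 'cV[R]_d) i :
  `|u i 0| ^+ 2 <= dot u u.
Proof.
rewrite /dot (bigD1 i)//= -expr2 real_normK ?num_real// lerDl.
by apply: sumr_ge0 => j _; rewrite -expr2 sqr_ge0.
Qed.

Lemma entry_le_of_dot_le (R : realType) d (u : 'cV[R]_d) i e :
  0 <= e -> dot u u <= e ^+ 2 -> `|u i 0| <= e.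
Proof.
move=> e0 ue; rewrite -(@ler_pXn2r _ 2)// ?nnegrE//.
exact: le_trans (sqr_entry_le_dot _ _) ue.
Qed.

(** * Limits of vectors along a filter *)

Lemma cvg_entries (R : realType) d (T : Type) (G : set_system T) {FG : Filter G}
    (u : T -> 'cV[R]_d) (l : 'cV[R]_d) :
  (forall i, u k i 0 @[k --> G] --> l i 0) -> u k @[k --> G] --> l.
Proof.
move=> ul; apply/cvg_ballP => e e0.
have : \forall k \near G, forall i, ball (l i 0) e (u k i 0).
  by apply: filter_forall => i; have /cvg_ballP := ul i; exact.
apply: filterS => k uk; split=> // i j.
by rewrite (ord1 j).
Qed.

Lemma cvg_entry (R : realType) d (T : Type) (G : set_system T) {FG : Filter G}
    (u : T -> 'cV[R]_d) (l : 'cV[R]_d) i :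
  u k @[k --> G] --> l -> u k i 0 @[k --> G] --> l i 0.
Proof.
by move=> ul; exact: (continuous_cvg _ (@coord_continuous _ _ _ i 0 l) ul).
Qed.

Lemma cvg_bigsum (R : realType) (T I : Type) (G : set_system T) {FG : Filter G}
    (r : seq I) (u : I -> T -> R) (l : I -> R) :
  (forall i, u i k @[k --> G] --> l i) ->
  (\sum_(i <- r) u i k) @[k --> G] --> \sum_(i <- r) l i.
Proof.
move=> ul; elim: r => [|i r IH].
  by under eq_cvg do rewrite big_nil; rewrite big_nil; exact: cvg_cst.
by under eq_cvg do rewrite big_cons; rewrite big_cons; exact: cvgD.
Qed.

Lemma cvg_dot (R : realType) d (T : Type) (G : set_system T) {FG : Filter G}
    (u v : T -> 'cV[R]_d) (a b : 'cV[R]_d) :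
  u k @[k --> G] --> a -> v k @[k --> G] --> b ->
  dot (u k) (v k) @[k --> G] --> dot a b.
Proof.
by move=> ua vb; apply: cvg_bigsum => i; apply: cvgM; exact: cvg_entry.
Qed.

Lemma cvg_mulmx (R : realType) d e (T : Type) (G : set_system T)
    {FG : Filter G} (M : 'M[R]_(e, d)) (u : T -> 'cV[R]_d) (a : 'cV[R]_d) :
  u k @[k --> G] --> a -> (M *m u k) @[k --> G] --> M *m a.
Proof.
move=> ua; apply: cvg_entries => i.
under eq_cvg do rewrite mxE; rewrite mxE.
by apply: cvg_bigsum => j; apply: cvgMr; exact: cvg_entry.
Qed.

Lemma cvg_of_dot_cvg0 (R : realType) d (T : Type) (G : set_system T)
    {FG : Filter G} (u : T -> 'cV[R]_d) :
  dot (u k) (u k) @[k --> G] --> 0 -> u k @[k --> G] --> (0 : 'cV[R]_d).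
Proof.
move=> u0; apply: cvg_entries => i; rewrite mxE.
apply/cvgr0Pnorm_lt => e e0.
have e2 : 0 < (e / 2) ^+ 2 by rewrite exprn_gt0// divr_gt0.
move/cvgr0Pnorm_lt : u0 => /(_ _ e2); apply: filterS => k.
rewrite ger0_norm ?dot_ge0// => /ltW uk.
apply: (@le_lt_trans _ _ (e / 2)); last first.
  by rewrite ltr_pdivrMr// ltr_pMr// ltr1n.
by apply: entry_le_of_dot_le uk; rewrite divr_ge0// ltW.
Qed.

(** Along a free ultrafilter every bounded sequence of vectors converges, so a
    single such filter does the work of extracting subsequences one coordinate,
    or one sequence, after the other. *)
Lemma free_ultrafilter : exists2 G : set_system nat, UltraFilter G & \oo `<=` G.
Proof.
by have [G [UG oG]] := ultraFilterLemma eventually_filter; exists G.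
Qed.

Lemma ultra_limit_real (R : realType) (G : set_system nat) {UG : UltraFilter G}
    (u : nat -> R) M :
  (forall k, `|u k| <= M) -> exists l : R, u k @[k --> G] --> l.
Proof.
move=> uM; have [|l [_ clul]] := @segment_compact R (- M) M (fmap u G) _.
  apply: (@filterS _ G _ setT) filterT => k _ /=.
  by rewrite in_itv/= -ler_norml.
exists l => B lB; have [//|GnB] := in_ultra_setVsetC (u @^-1` B) UG.
by have [t [? ?]] := clul (~` B) B GnB lB.
Qed.

Lemma ultra_limit (R : realType) d (G : set_system nat) {UG : UltraFilter G}
    (u : nat -> 'cV[R]_d) M :
  (forall k, dot (u k) (u k) <= M) -> exists l : 'cV[R]_d, u k @[k --> G] --> l.
Proof.
move=> uM.
have bound i k : `|u k i 0| <= M + 1.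
  apply: entry_le_of_dot_le; have := uM k; have := dot_ge0 (u k); nra.
have /choice[l ul] : forall i, exists l : R, u k i 0 @[k --> G] --> l.
  by move=> i; exact: ultra_limit_real (bound i).
exists (\col_i l i); apply: cvg_entries => i; rewrite mxE; exact: ul.
Qed.

(** * The spectral norm bounds the bilinear form of a matrix *)

Lemma dot_mulmx_le_entries (R : realType) d e (M : 'M[R]_(e, d))
    (u : 'cV[R]_d) : dot u u = 1 ->
  dot (M *m u) (M *m u) <= \sum_i (\sum_j `|M i j|) ^+ 2.
Proof.
move=> u1; apply: ler_sum => i _.
rewrite -expr2 -(@real_normK _ ((M *m u) i 0)) ?num_real//.
rewrite lerXn2r// ?nnegrE// ?sumr_ge0// mxE.
apply: le_trans (ler_norm_sum _ _ _) _; apply: ler_sum => j _.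
rewrite normrM ler_piMr//.
by apply: entry_le_of_dot_le => //; rewrite u1 expr1n.
Qed.

(** A maximising sequence on the unit sphere converges along a free ultrafilter
    to a maximiser; homogeneity then gives the bound off the sphere. *)
Lemma rayleigh_max (R : realType) d (M : 'M[R]_d) : (0 < d)%N ->
  exists2 v, dot v v = 1
    & forall u, dot (M *m u) (M *m u) <= dot (M *m v) (M *m v) * dot u u.
Proof.
case: d M => // d M _.
set E := [set dot (M *m u) (M *m u) | u in [set u | dot u u = 1]].
have ubE : has_ubound E.
  exists (\sum_i (\sum_j `|M i j|) ^+ 2) => _ [u u1 <-].
  exact: dot_mulmx_le_entries.
have supE : has_sup E.
  split=> //; exists (dot (M *m delta_mx 0 0) (M *m delta_mx 0 0)).
  exists (delta_mx 0 0) => //=.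
  rewrite /dot (bigD1 0)//= big1 ?addr0 => [|i /negbTE i0];
    rewrite !mxE ?eqxx ?mulr1//.
  by rewrite i0 mul0r.
have /choice[u uP] : forall k : nat, exists u : 'cV[R]_d.+1,
    dot u u = 1 /\ sup E - k.+1%:R^-1 < dot (M *m u) (M *m u).
  move=> k; have k0 : 0 < k.+1%:R^-1 :> R by rewrite invr_gt0.
  by have [_ [u u1 <-] ?] := sup_adherent k0 supE; exists u.
have [G UG oG] := free_ultrafilter.
have [v uv] : exists v : 'cV[R]_d.+1, u k @[k --> G] --> v.
  by apply: (@ultra_limit _ _ G _ _ 1) => k; have [-> _] := uP k.
have v1 : dot v v = 1.
  have h : dot (u k) (u k) @[k --> G] --> dot v v by exact: cvg_dot.
  have uu1 : (fun k => dot (u k) (u k)) = fun=> 1.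
    by apply/funext => k; have [] := uP k.
  by rewrite uu1 in h; exact: (cvg_unique _ h (cvg_cst _)).
have supv : sup E <= dot (M *m v) (M *m v).
  apply/ler_addgt0Pr => e e0; rewrite -lerBlDr.
  have Muv : dot (M *m u k) (M *m u k) @[k --> G] --> dot (M *m v) (M *m v).
    by apply: cvg_dot; exact: cvg_mulmx.
  apply: (cvgr_to_ge Muv); apply: oG.
  apply: filterS (near_infty_natSinv_lt (PosNum e0)) => k /= ke.
  by have [_ /ltW] := uP k; apply: le_trans; rewrite lerD2l lerN2 ltW.
exists v => // u0; have [->|u00] := eqVneq u0 0.
  by rewrite mulmx0 !dot0l mulr0.
have uu : 0 < dot u0 u0.
  by rewrite lt_def dot_ge0 andbT; apply: contra_neq u00; exact: dot_eq0.
set s := Num.sqrt (dot u0 u0).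
have s0 : 0 < s by rewrite sqrtr_gt0.
have s2 : dot u0 u0 = s ^+ 2 by rewrite sqr_sqrtr// dot_ge0.
have w1 : dot (s^-1 *: u0) (s^-1 *: u0) = 1.
  by rewrite dotZl dotZr s2; field; exact: lt0r_neq0.
have : dot (M *m (s^-1 *: u0)) (M *m (s^-1 *: u0)) <= sup E.
  by apply: ub_le_sup => //; exists (s^-1 *: u0).
move=> /le_trans/(_ supv).
rewrite -scalemxAr dotZl dotZr s2 mulrA -expr2 exprVn mulrC.
by rewrite ler_pdivrMr ?exprn_gt0.
Qed.

(** For small t the sign of t a + t^2 c is that of t a. *)
Lemma linear_term_eq0 (R : realType) (a c : R) :
  (forall t, 0 <= t * a + t ^+ 2 * c) -> a = 0.
Proof.
move=> h; apply/eqP; apply: contraT => a0.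
have a2 : 0 < a ^+ 2 by rewrite exprn_even_gt0.
have c1 : 0 < `|c| + 1 by rewrite ltr_wpDl.
(* A step against a, short enough for t a to dominate t^2 c. *)
have := h (- (a / (`|c| + 1)) / 2).
have -> : - (a / (`|c| + 1)) / 2 * a + (- (a / (`|c| + 1)) / 2) ^+ 2 * c =
  - (a ^+ 2 / (4 * (`|c| + 1) ^+ 2)) * (2 * (`|c| + 1) - c).
  by field; exact: lt0r_neq0.
have : 0 < a ^+ 2 / (4 * (`|c| + 1) ^+ 2).
  by rewrite divr_gt0// mulr_gt0// exprn_gt0.
have := ler_norm c; nra.
Qed.

(** A unit maximiser v of |M u|^2 is a critical point of mu |u|^2 - |M u|^2 for
    mu = |M v|^2, that is, an eigenvector of M^T M for mu. So sqrt mu is a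
    singular value, and it is the largest one since the Rayleigh quotient of
    every eigenvector is its eigenvalue. *)
Lemma mxnorm2_operator_bound (R : realType) d (M : 'M[R]_d) : (0 < d)%N ->
  0 <= mxnorm2 M /\
  forall u, dot (M *m u) (M *m u) <= mxnorm2 M ^+ 2 * dot u u.
Proof.
move=> d0; have [v v1 vmax] := rayleigh_max M d0.
set mu := dot (M *m v) (M *m v) in vmax *.
have mu0 : 0 <= mu by exact: dot_ge0.
have critical w : dot (mu *: v - M^T *m M *m v) w = 0.
  apply/eqP; rewrite -(mulrI_eq0 _ (lregP (_ : (2:R) != 0)))//; apply/eqP.
  apply: (@linear_term_eq0 _ _ (mu * dot w w - dot (M *m w) (M *m w))) => t.
  have := vmax (v + t *: w).
  rewrite mulmxDr -scalemxAr !(dotDl, dotDr, dotZl, dotZr, dotNl) -/mu v1.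
  rewrite -mulmxA -[dot (M^T *m _) _]dot_mulmx.
  rewrite (dotC w v) (dotC (M *m w) (M *m v)); lra.
have eigv : M^T *m M *m v = mu *: v.
  by apply/esym/eqP; rewrite -subr_eq0; apply/eqP/dot_eq0/critical.
have v0 : v != 0.
  by apply: contra_eq_neq v1 => ->; rewrite dot0l eq_sym oner_eq0.
have mu_eig : eigenvalue (M^T *m M) mu.
  apply/eigenvalueP; exists v^T; last by rewrite -(inj_eq trmx_inj) trmxK trmx0.
  by apply: trmx_inj; rewrite !trmx_mul !trmxK eigv linearZ/= trmxK.
have ubS : has_ubound (singular_values M).
  exists (Num.sqrt mu) => _ [l /eigenvalueP[w wl w0] <-].
  apply: ler_wsqrtr.
  have wt0 : 0 < dot w^T w^T.
    rewrite lt_def dot_ge0 andbT; apply: contra_neq w0 => /dot_eq0 wt.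
    by apply: trmx_inj; rewrite wt trmx0.
  have wlT : M^T *m M *m w^T = l *: w^T.
    by apply: trmx_inj; rewrite !trmx_mul !trmxK wl linearZ/= trmxK.
  by have := vmax w^T; rewrite dot_mulmx mulmxA wlT dotZl ler_pM2r.
have sqrt_le : Num.sqrt mu <= mxnorm2 M by apply: ub_le_sup => //; exists mu.
split; first exact: le_trans (sqrtr_ge0 _) sqrt_le.
move=> u; apply: le_trans (vmax u) _; rewrite ler_wpM2r ?dot_ge0//.
rewrite -(sqr_sqrtr mu0) lerXn2r// nnegrE ?sqrtr_ge0//.
exact: le_trans (sqrtr_ge0 _) sqrt_le.
Qed.

(** The squares |L u - w|^2 and |L u + w|^2 are nonnegative for w = M v. *)
Lemma dot_mulmx_le (R : realType) d e (M : 'M[R]_(e, d)) L : 0 <= L ->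
  (forall u, dot (M *m u) (M *m u) <= L ^+ 2 * dot u u) ->
  forall u v, `|dot u (M *m v)| <= L / 2 * (dot u u + dot v v).
Proof.
move=> L0 hM u v.
have := hM v; move: (M *m v) => w hw.
have [L00|Lneq] := eqVneq L 0.
  rewrite L00 (_ : w = 0) ?[dot _ 0]dotC ?dot0l ?normr0 ?mul0r//.
  rewrite L00 expr0n mul0r in hw.
  by apply: dot_eq0; apply/eqP; rewrite eq_le dot_ge0 andbT.
have {L0 Lneq} L0 : 0 < L by rewrite lt_def Lneq.
have := dot_ge0 (L *: u - w); have := dot_ge0 (L *: u + w).
rewrite !(dotBl, dotBr, dotDl, dotDr, dotZl, dotZr) (dotC w u) => h1 h2.
rewrite -(ler_pM2l L0) -[X in X * _](gtr0_norm L0) -normrM ler_norml.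
by apply/andP; split; nra.
Qed.

(** * Subgradients of convex functions *)

Definition subgradient (R : realType) d (F : 'cV[R]_d -> \bar R)
    (x g : 'cV[R]_d) : Prop :=
  forall z, (F x + (dot g (z - x))%:E <= F z)%E.

Lemma subgradient_fin (R : realType) d (F : 'cV[R]_d -> \bar R) x g :
  Defs.proper F -> subgradient F x g -> exists a, F x = a%:E.
Proof.
move=> [FNy [z Fz]] /(_ z) Fxz.
case Fx: (F x) Fxz => [a||] => [_|Fxz|_]; [by exists a| |by case: (FNy x)].
by case: Fz; apply/eqP; move: Fxz; rewrite addye// leye_eq.
Qed.

Lemma subgradient_monotone (R : realType) d (F : 'cV[R]_d -> \bar R) x g x' g' :
  Defs.proper F -> subgradient F x g -> subgradient F x' g' ->
  0 <= dot (g - g') (x - x').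
Proof.
move=> pF Fxg Fxg'; have [a Fx] := subgradient_fin pF Fxg.
have [a' Fx'] := subgradient_fin pF Fxg'.
have := Fxg x'; have := Fxg' x; rewrite Fx Fx' -!EFinD !lee_fin.
rewrite !(dotBl, dotBr); lra.
Qed.

(** If F (xh) + <gh, z - xh> > F z, then lower semicontinuity keeps F (x k)
    above a level which the subgradient inequalities at x k forbid in the
    limit. *)
Lemma subgradient_limit (R : realType) d (F : 'cV[R]_d -> \bar R)
    (T : Type) (G : set_system T) {FG : ProperFilter G}
    (x g : T -> 'cV[R]_d) (xh gh : 'cV[R]_d) :
  lower_semicontinuous F -> Defs.proper F ->
  (\forall k \near G, subgradient F (x k) (g k)) ->
  x k @[k --> G] --> xh -> g k @[k --> G] --> gh -> subgradient F xh gh.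
Proof.
move=> lscF [FNy _] Fxg xxh ggh z.
case Fz: (F z) => [r||]; [|by rewrite leey|by case: (FNy z)].
have below a : (a%:E < F xh)%E -> a + dot gh (z - xh) <= r.
  move=> /lscF[V Vxh VF]; rewrite -lerBrDr.
  have lim : r - dot (g k) (z - x k) @[k --> G] --> r - dot gh (z - xh).
    have zx : z - x k @[k --> G] --> z - xh by apply: cvgB => //; exact: cvg_cst.
    by apply: cvgB; [exact: cvg_cst|exact: cvg_dot].
  have GV : \forall k \near G, V (x k) by exact: xxh.
  apply: (cvgr_to_ge lim); apply: filterS (filterI GV Fxg) => k /= [Vxk /(_ z)].
  have := VF _ Vxk; rewrite Fz; case: (F (x k)) => [s||]//.
    by rewrite -EFinD lte_fin lee_fin; lra.
case Fxh: (F xh) below => [s||] below; last by case: (FNy xh).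
  rewrite -EFinD lee_fin leNgt; apply/negP => lt.
  have := below ((r - dot gh (z - xh) + s) / 2); rewrite lte_fin.
  by lra.
by exfalso; have := below (r - dot gh (z - xh) + 1) (ltry _); lra.
Qed.

(** Fermat's rule: compare x with the points x + t (v - x) of a segment, divide
    by t and let t tend to 0; only the linear term of Q is left. *)
Lemma subgradient_of_argmin (R : realType) d (f : 'cV[R]_d -> \bar R)
    (Q : 'cV[R]_d -> R) (x g : 'cV[R]_d) (K : 'cV[R]_d -> R) :
  econvex f -> Defs.proper f ->
  (forall v t, Q (x + t *: v) = Q x + t * dot g v + t ^+ 2 * K v) ->
  (forall v, f x + (Q x)%:E <= f v + (Q v)%:E)%E ->
  subgradient f x (- g).
Proof.
move=> cf [fNy [v0 fv0]] Qexp xmin v.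
have [a fx] : exists a, f x = a%:E.
  have := xmin v0; case: (f x) (fNy x) => [a||]// _; first by exists a.
  case: (f v0) (fNy v0) fv0 => [r||]// _ _.
case fv: (f v) => [r||]; [|by rewrite leey|by case: (fNy v)].
rewrite fx -EFinD lee_fin dotNl.
suff : forall t, 0 < t < 1 -> a - dot g (v - x) <= r + t * K (v - x).
  move=> h; apply/ler_addgt0Pr => e e0.
  (* Small enough for t |K (v - x)| <= e, and strictly between 0 and 1. *)
  pose t := Num.min (1 / 2) (e / (`|K (v - x)| + 1)).
  have K1 : 0 < `|K (v - x)| + 1 by rewrite ltr_wpDl.
  have t0 : 0 < t by rewrite lt_min divr_gt0//= divr_gt0.
  have t1 : t < 1 by rewrite gt_min; apply/orP; left; lra.
  have te : t * (`|K (v - x)| + 1) <= e by rewrite -ler_pdivlMr// ge_min lexx orbT.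
  have := h t; rewrite t0 t1 => /(_ isT); have := ler_norm (K (v - x)); nra.
move=> t /andP[t0 t1].
have := cf v x t; rewrite t0 t1 => /(_ isT).
have -> : t *: v + (1 - t) *: x = x + t *: (v - x).
  by rewrite scalerBl scale1r scalerBr addrC -addrA [- _ + _]addrC.
have := xmin (x + t *: (v - x)); rewrite Qexp fx fv -!EFinM -!EFinD.
case: (f _) (fNy (x + t *: (v - x))) => [w||]// _.
rewrite -!EFinD !lee_fin => h1 h2.
have : t * (a - dot g (v - x)) <= t * (r + t * K (v - x)) by lra.
by rewrite ler_pM2l.
Qed.

(** * Lagrange multipliers *)

Definition supported_below (R : realType) m k (u : 'cV[R]_m) : Prop :=
  forall i : 'I_m, (k <= i)%N -> u i 0 = 0.

(** G is a convex subset of R^m x R lying above 0 over the origin, whose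
    projection to R^m has the origin in its relative interior: the last
    condition allows every u of the projection to be flipped through the origin.
    Such a G lies above a linear functional, which is built one coordinate at a
    time as in the Hahn-Banach theorem. A point of G with positive j-th
    coordinate bounds the new coefficient from above and one with negative j-th
    coordinate bounds it from below; the two bounds are compatible because the
    segment between the two points meets the hyperplane u_j = 0, where the
    functional already built applies. *)
Lemma supporting_functional (R : realType) m (G : 'cV[R]_m -> R -> Prop) :
  (forall u c v d t, 0 < t < 1 -> G u c -> G v d ->
     G (t *: u + (1 - t) *: v) (t * c + (1 - t) * d)) ->
  (forall c, G 0 c -> 0 <= c) ->
  (forall u c, G u c -> exists2 e, 0 < e & exists d, G (- e *: u) d) ->
  exists p : 'cV[R]_m, forall u c, G u c -> dot p u <= c.
Proof.
move=> Gconv G0 Gflip.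
suff H k : exists p : 'cV[R]_m,
    forall u c, G u c -> supported_below k u -> dot p u <= c.
  have [p hp] := H m; exists p => u c Guc; apply: hp Guc _ => i.
  by rewrite leqNgt ltn_ord.
elim: k => [|k [p hp]].
  exists 0 => u c Guc u0; rewrite dot0l; apply: G0.
  by rewrite (_ : 0 = u)//; apply/colP => i; rewrite mxE u0.
have [km|mk] := ltnP k m; last first.
  exists p => u c Guc _; apply: hp Guc _ => i ki.
  by have := ltn_ord i; rewrite ltnNge (leq_trans mk ki).
pose j := Ordinal km.
have below u : supported_below k.+1 u -> u j 0 = 0 -> supported_below k u.
  move=> uk uj i; rewrite leq_eqVlt => /orP[/eqP ki|]; last exact: uk.
  by rewrite (_ : i = j)//; exact/val_inj.
pose Gk u c := G u c /\ supported_below k.+1 u.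
have cross u c v d : Gk u c -> Gk v d -> 0 < u j 0 -> v j 0 < 0 ->
    (dot p v - d) / - v j 0 <= (c - dot p u) / u j 0.
  move=> [Guc uk] [Gvd vk] uj vj.
  (* The weight for which t u + (1 - t) v has vanishing j-th coordinate. *)
  pose t := - v j 0 / (u j 0 - v j 0).
  have D0 : 0 < u j 0 - v j 0 by lra.
  have tD : t * (u j 0 - v j 0) = - v j 0 by rewrite /t; field; exact: lt0r_neq0.
  move: (t) tD => {}t tD.
  have t01 : 0 < t < 1 by apply/andP; split; nra.
  have := hp _ _ (Gconv _ _ _ _ _ t01 Guc Gvd).
  rewrite dotDr !dotZr => /(_ _)/wrap[].
    apply: below => [i ki|]; rewrite !mxE; first by rewrite uk// vk// !mulr0 addr0.
    by lra.
  move=> h; rewrite ler_pdivrMr ?oppr_gt0// mulrAC ler_pdivlMr//.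
  have h' : (1 - t) * (dot p v - d) <= t * (c - dot p u) by lra.
  have := ler_wpM2l (ltW D0) h'; rewrite !mulrA.
  have -> : (u j 0 - v j 0) * (1 - t) = u j 0 by lra.
  rewrite [_ * t]mulrC tD.
  lra.
pose S := [set (dot p w.1 - w.2) / - w.1 j 0
  | w in [set w | Gk w.1 w.2 /\ w.1 j 0 < 0]].
suff [a [alo ahi]] : exists a : R,
    (forall v d, Gk v d -> v j 0 < 0 -> (dot p v - d) / - v j 0 <= a) /\
    (forall u c, Gk u c -> 0 < u j 0 -> a <= (c - dot p u) / u j 0).
  exists (p + a *: delta_mx j 0) => u c Guc uk.
  have -> : dot (p + a *: delta_mx j 0) u = dot p u + a * u j 0.
    rewrite dotDl dotZl; congr (_ + _ * _); rewrite /dot (bigD1 j)//= big1 ?addr0.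
      by rewrite !mxE !eqxx mul1r.
    by move=> i /negbTE ij; rewrite !mxE ij mul0r.
  have [uj|uj|uj] := ltgtP (u j 0) 0.
  - have := alo u c (conj Guc uk) uj; rewrite ler_pdivrMr ?oppr_gt0//; lra.
  - have := ahi u c (conj Guc uk) uj; rewrite ler_pdivlMr//; lra.
  - by rewrite uj mulr0 addr0; apply: hp Guc _; exact: below.
have flip u c : Gk u c ->
    exists v d, Gk v d /\ exists2 e, 0 < e & v j 0 = - e * u j 0.
  move=> [/Gflip[e e0 [d Gvd]] uk]; exists (- e *: u), d; split.
    by split=> // i ki; rewrite mxE uk// mulr0.
  by exists e; rewrite ?mxE.
have [[[u c] [/= Guc uj]]|noneg] := pselect (exists w, Gk w.1 w.2 /\ w.1 j 0 < 0).
  have [v [d [Gvd [e e0 vE]]]] := flip _ _ Guc.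
  have vj : 0 < v j 0 by rewrite vE; nra.
  have S0 : S !=set0 by exists ((dot p u - c) / - u j 0), (u, c).
  have ubS u1 c1 : Gk u1 c1 -> 0 < u1 j 0 -> ubound S ((c1 - dot p u1) / u1 j 0).
    by move=> ? ? _ [[w cw] [/= Gw wj] <-]; exact: cross.
  exists (sup S); split=> [w cw Gw wj|w cw Gw wj].
    apply: ub_le_sup; last by exists (w, cw).
    by exists ((d - dot p v) / v j 0); exact: ubS.
  by apply: ge_sup => //; exact: ubS.
(* No point has negative j-th coordinate, so by flipping none has positive. *)
exists 0; split=> [v d Gvd vj|u c Guc uj].
  by case: noneg; exists (v, d).
have [v [d [Gvd [e e0 vE]]]] := flip _ _ Guc.
by case: noneg; exists (v, d); split=> //=; rewrite vE; nra.
Qed.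

(** A point of the relative interior can be moved a little away from any point
    of C: the result stays in the affine hull, hence in C. *)
Lemma relint_flip (R : realType) d (C : set 'cV[R]_d) (x0 x : 'cV[R]_d) :
  relint C x0 -> C x -> exists2 e, 0 < e & C (x0 - e *: (x - x0)).
Proof.
move=> [Cx0 [U Ux0 UC]] Cx.
have lim : x0 - t *: (x - x0) @[t --> (0:R)^'+] --> x0.
  rewrite -[X in _ --> X]subr0 -(scale0r (x - x0)).
  apply: cvgB; first exact: cvg_cst.
  apply: cvgZl; apply: cvg_at_right_filter; exact: cvg_id.
have [e [Ue e0]] : exists e, U (x0 - e *: (x - x0)) /\ 0 < e.
  apply: (@filter_ex _ (0:R)^'+); apply: filterI; last exact: nbhs_right_gt.
  exact: lim Ux0.
exists e => //; apply: UC; split => //.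
exists 2, (fun i => if i == 0 then 1 + e else - e).
exists (fun i => if i == 0 then x0 else x).
split.
- by move=> i; case: ifP.
- by rewrite !big_ord_recl big_ord0/= addr0 addrK.
- rewrite !big_ord_recl big_ord0/= addr0 scalerDl scale1r scalerBr scaleNr opprB.
  by rewrite addrA.
Qed.

(** The functional p supports the epigraph of the value function
    u |-> inf {F x | A x - b = u}, shifted down by its value F xs at the origin.
    The relative interior condition on x0 provides the flips required by
    [supporting_functional]. *)
Lemma lagrange_multiplier (R : realType) N m (F : 'cV[R]_N -> \bar R)
    (A : 'M[R]_(m, N)) (b : 'cV[R]_m) (x0 xs : 'cV[R]_N) :
  econvex F -> (forall x, F x <> -oo%E) ->
  relint (edom F) x0 -> A *m x0 = b ->
  A *m xs = b -> (forall z, A *m z = b -> (F xs <= F z)%E) ->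
  exists ys, subgradient F xs (- (A^T *m ys)).
Proof.
move=> cF FNy rx0 Ax0 Axs xsmin.
have [fs Fxs] : exists fs, F xs = fs%:E.
  have := xsmin _ Ax0; have := rx0.1; rewrite /edom/=.
  case: (F xs) (FNy xs) => [a||]// _; first by exists a.
  by rewrite leye_eq => /[swap] /eqP ->.
pose G u c := exists x, (F x <= (c + fs)%:E)%E /\ A *m x - b = u.
have [|||p pG] := @supporting_functional R m G.
- move=> _ c _ d t t01 [x [Fx <-]] [z [Fz <-]]; exists (t *: x + (1 - t) *: z).
  have /andP[t0 t1] := t01.
  split; last first.
    rewrite mulmxDr -!scalemxAr !scalerBr addrACA -opprD -scalerDl.
    by rewrite [t + _]addrC subrK scale1r.
  apply: le_trans (cF _ _ _ t01) _.
  have -> : t * c + (1 - t) * d + fs = t * (c + fs) + (1 - t) * (d + fs) by ring.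
  rewrite [leRHS]EFinD !EFinM.
  by apply: leeD; apply: lee_wpmul2l => //; rewrite lee_fin; lra.
- move=> c [x [Fx /eqP]]; rewrite subr_eq0 => /eqP/xsmin.
  by rewrite Fxs => /le_trans/(_ Fx); rewrite lee_fin; lra.
- move=> _ c [x [Fx <-]].
  have [|e e0 /= xe] := relint_flip rx0 (_ : edom F x).
    by apply: le_lt_trans Fx _; rewrite ltry.
  exists e => //.
  move: xe; rewrite /edom /=.
  case Fe: (F _) => [r||]// _; last by case: (FNy (x0 - e *: (x - x0))).
  exists (r - fs), (x0 - e *: (x - x0)); rewrite Fe subrK; split=> //.
  by rewrite mulmxBr -scalemxAr mulmxBr Ax0 scaleNr addrAC subrr sub0r.
exists (- p) => z; rewrite Fxs.
case Fz: (F z) => [r||]; [|by rewrite leey|by case: (FNy z)].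
have : G (A *m z - b) (r - fs) by exists z; rewrite subrK Fz.
move=> /pG; rewrite mulmxN opprK -dot_mulmx mulmxBr Axs -EFinD lee_fin; lra.
Qed.

(** * Convergence of the forward-reflected iteration *)

Definition lyapunov (R : realType) N m (D U : 'M[R]_N) (L beta : R)
    (e d : 'cV[R]_N) (r : 'cV[R]_m) : R :=
  dot e (D *m e) - 2 * dot e (U *m d) + L * dot d d + dot r r / beta ^+ 2.

(** Here e, d and r are the primal error, the last increment and the dual error
    before a step, and d', r' the increment and the dual error after it. The
    last hypothesis is the monotonicity inequality between the new iterate and
    the saddle point. The cross term <d', U d> it produces is split evenly, at the
    price L |d'|^2 + L |d|^2; the part in d is paid for by the summand L |d|^2
    of the Lyapunov function. *)
Lemma lyapunov_step (R : realType) N m (A : 'M[R]_(m, N)) (D U : 'M[R]_N)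
    (c L beta : R) (e d d' : 'cV[R]_N) (r r' : 'cV[R]_m) :
  0 < beta -> D^T = D ->
  (forall u, c * dot u u <= dot u (D *m u)) ->
  (forall u v, `|dot u (U *m v)| <= L / 2 * (dot u u + dot v v)) ->
  A *m (e + d') = beta^-1 *: (r' - r) ->
  0 <= dot (beta *: (U *m (d' - d) - D *m d') - A^T *m r') (e + d') ->
  lyapunov D U L beta (e + d') d' r'
    + ((c - 2 * L) * dot d' d' + dot (r' - r) (r' - r) / beta ^+ 2)
  <= lyapunov D U L beta e d r.
Proof.
move=> b0 Dsym hD hU feas.
move=> mono; rewrite dotBl -dot_mulmx feas dotZr (dotC _ (e + d')) in mono.
have b1 : 0 < beta^-1 by rewrite invr_gt0.
have := ler_wpM2l (ltW b1) mono.
rewrite mulr0 dotZr mulrBr mulrA mulVf ?lt0r_neq0// mul1r mulrA -expr2 exprVn.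
have := hU d' d; rewrite ler_norml => /andP[hb _].
have := hD d'.
have symD : dot d' (D *m e) = dot e (D *m d') by rewrite dot_mulmx Dsym dotC.
rewrite /lyapunov !mulmxBr !mulmxDr !(dotDl, dotDr, dotNl, dotNr, dotZr) symD.
rewrite (dotC r r'); lra.
Qed.

Lemma lyapunov_coercive (R : realType) N m (D U : 'M[R]_N) (c L beta : R)
    (e d : 'cV[R]_N) (r : 'cV[R]_m) :
  (forall u, c * dot u u <= dot u (D *m u)) ->
  (forall u v, `|dot u (U *m v)| <= L / 2 * (dot u u + dot v v)) ->
  (c - L) * dot e e + dot r r / beta ^+ 2 <= lyapunov D U L beta e d r.
Proof.
move=> hD hU; have := hD e; have := hU e d; rewrite ler_norml => /andP[_ hb].
rewrite /lyapunov; lra.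
Qed.

(** The given saddle point (xs, ys) yields boundedness and vanishing increments.
    The limit (xh, yh) along a free ultrafilter is a saddle point in its turn,
    and the Lyapunov function based at (xh, yh) forces convergence of the whole
    sequence. *)
Lemma forward_reflected_cvg (R : realType) N m (F : 'cV[R]_N -> \bar R)
    (A : 'M[R]_(m, N)) (b : 'cV[R]_m) (D U : 'M[R]_N) (c L beta : R)
    (x : nat -> 'cV[R]_N) (y : nat -> 'cV[R]_m) xs ys :
  lower_semicontinuous F -> Defs.proper F ->
  0 < beta -> 0 <= L -> 2 * L < c -> D^T = D ->
  (forall u, c * dot u u <= dot u (D *m u)) ->
  (forall u v, `|dot u (U *m v)| <= L / 2 * (dot u u + dot v v)) ->
  (forall k, subgradient F (x k.+2)
     (beta *: (U *m ((x k.+2 - x k.+1) - (x k.+1 - x k))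
        - D *m (x k.+2 - x k.+1)) - A^T *m y k.+2)) ->
  (forall k, y k.+2 = y k.+1 + beta *: (A *m x k.+2 - b)) ->
  A *m xs = b -> subgradient F xs (- (A^T *m ys)) ->
  exists xh yh, [/\ A *m xh = b, subgradient F xh (- (A^T *m yh))
    & x k @[k --> \oo] --> xh].
Proof.
move=> lscF pF b0 L0 Lc Dsym hD hU hx hy.
pose V xs ys k :=
  lyapunov D U L beta (x k.+1 - xs) (x k.+1 - x k) (y k.+1 - ys).
pose drop k := (c - 2 * L) * dot (x k.+2 - x k.+1) (x k.+2 - x k.+1)
  + dot (y k.+2 - y k.+1) (y k.+2 - y k.+1) / beta ^+ 2.
have cL : 0 < c - L by lra.
have bV2 : 0 < (beta ^+ 2)^-1 by rewrite invr_gt0 exprn_gt0.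
have drop_ge0 k : 0 <= drop k.
  apply: addr_ge0; apply: mulr_ge0; rewrite ?dot_ge0 ?(ltW bV2)//; lra.
have descent p q : A *m p = b -> subgradient F p (- (A^T *m q)) ->
    forall k, V p q k.+1 + drop k <= V p q k.
  move=> Ap Fp k.
  have -> : V p q k.+1 = lyapunov D U L beta
      ((x k.+1 - p) + (x k.+2 - x k.+1)) (x k.+2 - x k.+1) (y k.+2 - q).
    by rewrite /V; congr lyapunov; rewrite [RHS]addrC subrKA.
  have -> : drop k = (c - 2 * L) * dot (x k.+2 - x k.+1) (x k.+2 - x k.+1)
      + dot ((y k.+2 - q) - (y k.+1 - q)) ((y k.+2 - q) - (y k.+1 - q))
        / beta ^+ 2.
    by rewrite opprB addrA subrK.
  have xp : x k.+1 - p + (x k.+2 - x k.+1) = x k.+2 - p by rewrite addrC subrKA.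
  apply: (lyapunov_step (A := A)) => //; rewrite xp.
    rewrite opprB addrA subrK (hy k) [y _ + _]addrC addrK scalerA mulVf.
      by rewrite scale1r mulmxBr Ap.
    exact: lt0r_neq0.
  have := subgradient_monotone pF (hx k) Fp.
  by move: (beta *: _) => W; rewrite opprK mulmxBr opprB addrA addrAC.
have V_ge p q k : (c - L) * dot (x k.+1 - p) (x k.+1 - p)
    + dot (y k.+1 - q) (y k.+1 - q) / beta ^+ 2 <= V p q k.
  exact: lyapunov_coercive.
have V_ge0 p q k : 0 <= V p q k.
  apply: le_trans (V_ge p q k).
  by apply: addr_ge0; apply: mulr_ge0; rewrite ?dot_ge0 ?ltW.
have V_dec p q : A *m p = b -> subgradient F p (- (A^T *m q)) ->
    nonincreasing_seq (V p q).
  move=> Ap Fp; apply/nonincreasing_seqP => k.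
  by have := descent _ _ Ap Fp k; have := drop_ge0 k; lra.
have V_cvg p q : A *m p = b -> subgradient F p (- (A^T *m q)) -> cvgn (V p q).
  move=> Ap Fp; apply: nonincreasing_is_cvgn; first exact: V_dec.
  by exists 0 => _ [k _ <-].
move=> Axs Fxs.
have drop0 : drop k @[k --> \oo] --> 0.
  have l := V_cvg _ _ Axs Fxs.
  apply: (@squeeze_cvgr _ _ _ _ (fun=> 0) (fun k => V xs ys k - V xs ys k.+1)).
  - by near=> k; rewrite drop_ge0/=; have := descent _ _ Axs Fxs k; lra.
  - exact: cvg_cst.
  - rewrite -(subrr (limn (V xs ys))); apply: cvgB; first exact: l.
    by rewrite -(cvg_shiftS (V xs ys)) in l.
have d0 : x k.+2 - x k.+1 @[k --> \oo] --> (0 : 'cV[R]_N).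
  apply: cvg_of_dot_cvg0.
  apply: (@squeeze_cvgr _ _ _ _ (fun=> 0) (fun k => (c - 2 * L)^-1 * drop k)).
  - near=> k; rewrite dot_ge0/= mulrC ler_pdivlMr; last lra.
    rewrite /drop mulrC lerDl mulr_ge0 ?dot_ge0// ltW//.
  - exact: cvg_cst.
  - by rewrite -(mulr0 (c - 2 * L)^-1); apply: cvgMr.
have dy0 : y k.+2 - y k.+1 @[k --> \oo] --> (0 : 'cV[R]_m).
  apply: cvg_of_dot_cvg0.
  apply: (@squeeze_cvgr _ _ _ _ (fun=> 0) (fun k => beta ^+ 2 * drop k)).
  - near=> k; rewrite dot_ge0/= /drop mulrDr [_ * (_ / _)]mulrCA.
    rewrite mulfV ?expf_neq0 ?lt0r_neq0//.
    rewrite mulr1 lerDr; apply: mulr_ge0; first by rewrite exprn_ge0// ltW.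
    by apply: mulr_ge0; [lra|exact: dot_ge0].
  - exact: cvg_cst.
  - by rewrite -(mulr0 (beta ^+ 2)); apply: cvgMr.
have V_le k : V xs ys k <= V xs ys 0 by apply: V_dec.
have [G UG oG] := free_ultrafilter.
have [ex exP] : exists l : 'cV[R]_N, x k.+2 - xs @[k --> G] --> l.
  apply: (@ultra_limit _ _ G _ _ (V xs ys 0 / (c - L))) => k.
  rewrite ler_pdivlMr// mulrC; apply: le_trans (V_le k.+1).
  apply: le_trans (V_ge _ _ _).
  by rewrite lerDl mulr_ge0 ?dot_ge0// ltW.
have [ey eyP] : exists l : 'cV[R]_m, y k.+2 - ys @[k --> G] --> l.
  apply: (@ultra_limit _ _ G _ _ (V xs ys 0 * beta ^+ 2)) => k.
  rewrite -ler_pdivrMr ?exprn_gt0//; apply: le_trans (V_le k.+1).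
  apply: le_trans (V_ge _ _ _).
  by rewrite lerDr mulr_ge0 ?dot_ge0// ltW.
pose xh := ex + xs; pose yh := ey + ys.
have xG : x k.+2 @[k --> G] --> xh.
  have : (x k.+2 - xs) + xs @[k --> G] --> ex + xs.
    by apply: cvgD => //; exact: cvg_cst.
  by under eq_cvg do rewrite subrK.
have yG : y k.+2 @[k --> G] --> yh.
  have : (y k.+2 - ys) + ys @[k --> G] --> ey + ys.
    by apply: cvgD => //; exact: cvg_cst.
  by under eq_cvg do rewrite subrK.
have d0G : x k.+2 - x k.+1 @[k --> G] --> (0 : 'cV[R]_N).
  exact: cvg_trans (cvg_app _ oG) d0.
have dy0G : y k.+2 - y k.+1 @[k --> G] --> (0 : 'cV[R]_m).
  exact: cvg_trans (cvg_app _ oG) dy0.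
have d1G : x k.+1 - x k @[k --> G] --> (0 : 'cV[R]_N).
  apply: cvg_trans (cvg_app _ oG) _.
  by rewrite -(cvg_shiftS (fun k => x k.+1 - x k)).
have AxG : A *m x k.+2 @[k --> G] --> A *m xh by exact: cvg_mulmx.
have Axh : A *m xh = b.
  have Ax k : A *m x k.+2 = beta^-1 *: (y k.+2 - y k.+1) + b.
    by rewrite hy [y _ + _]addrC addrK scalerA mulVf ?lt0r_neq0// scale1r subrK.
  have : A *m x k.+2 @[k --> G] --> beta^-1 *: (0 : 'cV[R]_m) + b.
    under eq_cvg do rewrite Ax.
    by apply: cvgD; [exact: cvgZr|exact: cvg_cst].
  rewrite scaler0 add0r => AxGb; exact: (cvg_unique _ AxG AxGb).
have Fxh : subgradient F xh (- (A^T *m yh)).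
  have gG : beta *: (U *m ((x k.+2 - x k.+1) - (x k.+1 - x k))
        - D *m (x k.+2 - x k.+1)) - A^T *m y k.+2 @[k --> G] -->
      beta *: (U *m (0 - 0) - D *m 0) - A^T *m yh.
    apply: cvgB; last exact: cvg_mulmx.
    apply: cvgZr; apply: cvgB; apply: cvg_mulmx;
      [exact: cvgB d0G d1G|exact: d0G].
  rewrite subr0 !mulmx0 subr0 scaler0 sub0r in gG.
  by apply: subgradient_limit xG gG => //; apply: nearW => k; exact: hx.
exists xh, yh; split; [exact: Axh|exact: Fxh|].
have V0 : limn (V xh yh) = 0.
  have VG : V xh yh k.+1 @[k --> G] --> limn (V xh yh).
    apply: cvg_trans (cvg_app _ oG) _.
    by rewrite (cvg_shiftS (V xh yh)); exact: V_cvg.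
  have eG : x k.+2 - xh @[k --> G] --> (0 : 'cV[R]_N).
    by rewrite -(subrr xh); apply: cvgB; [exact: xG|exact: cvg_cst].
  have rG : y k.+2 - yh @[k --> G] --> (0 : 'cV[R]_m).
    by rewrite -(subrr yh); apply: cvgB; [exact: yG|exact: cvg_cst].
  have : V xh yh k.+1 @[k --> G] --> dot (0 : 'cV[R]_N) (D *m 0)
      - 2 * dot (0 : 'cV[R]_N) (U *m 0) + L * dot (0 : 'cV[R]_N) 0
      + dot (0 : 'cV[R]_m) 0 / beta ^+ 2.
    apply: cvgD; last by apply: cvgMl; exact: cvg_dot.
    apply: cvgD; last by apply: cvgMr; exact: cvg_dot.
    apply: cvgB; first by apply: cvg_dot; [exact: eG|apply: cvg_mulmx; exact: eG].
    by apply: cvgMr; apply: cvg_dot; [exact: eG|apply: cvg_mulmx; exact: d0G].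
  by rewrite !dot0l !mulr0 mul0r subr0 !addr0 => VG0; exact: (cvg_unique _ VG VG0).
have V_cvg0 : V xh yh k @[k --> \oo] --> 0 by rewrite -V0; exact: V_cvg.
have e0 : x k.+1 - xh @[k --> \oo] --> (0 : 'cV[R]_N).
  apply: cvg_of_dot_cvg0.
  apply: (@squeeze_cvgr _ _ _ _ (fun=> 0) (fun k => (c - L)^-1 * V xh yh k)).
  - near=> k; rewrite dot_ge0/= mulrC ler_pdivlMr// mulrC.
    by apply: le_trans (V_ge _ _ _); rewrite lerDl mulr_ge0 ?dot_ge0// ltW.
  - exact: cvg_cst.
  - by rewrite -(mulr0 (c - L)^-1); apply: cvgMr.
rewrite -cvg_shiftS -(add0r xh).
have xE : (fun k => x k.+1) = fun k => (x k.+1 - xh) + xh.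
  by apply/funext => k; rewrite subrK.
by rewrite xE; apply: cvgD; [exact: e0|exact: cvg_cst].
Unshelve. all: by end_near.
Qed.

(** * Block structure *)

Lemma submxcolZ (R : realType) s (n : 'I_s -> nat) (a : R)
    (u : 'cV[R]_(\sum_(i < s) n i)) i : submxcol (a *: u) i = a *: submxcol u i.
Proof. by apply/matrixP => k l; rewrite !mxE. Qed.

Lemma dot_submxcol (R : realType) s (n : 'I_s -> nat)
    (u v : 'cV[R]_(\sum_(i < s) n i)) :
  dot u v = \sum_i dot (submxcol u i) (submxcol v i).
Proof.
rewrite dotE -[u]submxcolK -[v in LHS]submxcolK tr_mxcol mul_mxrow_mxcol summxE.
by apply: eq_bigr => i _; rewrite mxcolK dotE.
Qed.

Lemma mulmx_mxrow (R : realType) s m (n : 'I_s -> nat)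
    (A : forall i, 'M[R]_(m, n i)) (x : 'cV[R]_(\sum_(i < s) n i)) :
  \mxrow_(i < s) A i *m x = \sum_(i < s) A i *m submxcol x i.
Proof. by rewrite -{1}[x]submxcolK mul_mxrow_mxcol. Qed.

Lemma sepsum_Ny (R : realType) s (n : 'I_s -> nat)
    (f : forall i, 'cV[R]_(n i) -> \bar R) :
  (forall i v, f i v <> -oo%E) -> forall x, sepsum f x <> -oo%E.
Proof. by move=> fNy x /esum_eqNyP[i [_ _ /fNy]]. Qed.

Lemma econvex_sepsum (R : realType) s (n : 'I_s -> nat)
    (f : forall i, 'cV[R]_(n i) -> \bar R) :
  (forall i v, f i v <> -oo%E) -> (forall i, econvex (f i)) ->
  econvex (sepsum f).
Proof.
move=> fNy cf x y t t01; rewrite /sepsum !fin_num_sume_distrr//; last 2 first.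
- by move=> i j _ _; apply: ltninfty_adde_def; rewrite inE ltNye; exact/eqP.
- by move=> i j _ _; apply: ltninfty_adde_def; rewrite inE ltNye; exact/eqP.
rewrite -big_split/=; apply: lee_sum => i _.
by rewrite submxcolD !submxcolZ; exact: cf.
Qed.

(** Lowers every term a little, or, when some term is infinite, lowers the
    others by 1 and gives that term all that is then missing. *)
Lemma sum_lt_split (R : realType) s (e : 'I_s -> \bar R) (a : R) :
  (forall i, e i <> -oo%E) -> (a%:E < \sum_i e i)%E ->
  exists2 r : 'I_s -> R, forall i, ((r i)%:E < e i)%E & a < \sum_i r i.
Proof.
move=> eNy; have [[i0 ei0] _|ey] := pselect (exists i, e i = +oo%E).
  pose r i := if i == i0 then a + 1 - \sum_(j | j != i0) (fine (e j) - 1)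
    else fine (e i) - 1.
  exists r => [i|].
    rewrite /r; case: eqP => [->|_]; first by rewrite ei0 ltry.
    by case: (e i) (eNy i) => [x||]//= _; rewrite ?ltry// lte_fin; lra.
  rewrite (bigD1 i0)//= {1}/r eqxx.
  under eq_bigr => i /negbTE ii0 do rewrite /r ii0.
  by rewrite subrK; lra.
have ef i : e i = (fine (e i))%:E.
  by case ei: (e i) => [x||]//; [case: ey; exists i|case: (eNy i)].
under eq_bigr do rewrite ef.
rewrite sumEFin lte_fin => lt.
have s1 : 0 < s.+1%:R :> R by [].
pose dl := (\sum_i fine (e i) - a) / s.+1%:R.
have dl0 : 0 < dl by rewrite divr_gt0// subr_gt0.
exists (fun i => fine (e i) - dl) => [i|].
  by rewrite [ltRHS]ef lte_fin; lra.
rewrite big_split/= sumrN sumr_const card_ord -mulr_natr.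
have : dl * s.+1%:R = \sum_i fine (e i) - a by rewrite /dl divfK// lt0r_neq0.
by rewrite -natr1; lra.
Qed.

Lemma lower_semicontinuous_sepsum (R : realType) s (n : 'I_s -> nat)
    (f : forall i, 'cV[R]_(n i) -> \bar R) :
  (forall i v, f i v <> -oo%E) -> (forall i, lower_semicontinuous (f i)) ->
  lower_semicontinuous (sepsum f).
Proof.
move=> fNy lf x a /(sum_lt_split (fun i => fNy i _))[r rf ar].
exists [set y | forall i, ((r i)%:E < f i (submxcol y i))%E]; last first.
  move=> y /= ry; apply: lt_le_trans (_ : (\sum_i (r i))%:E <= _)%E.
    by rewrite lte_fin.
  by rewrite -sumEFin; apply: lee_sum => i _; exact/ltW.
suff : \forall y \near x, forall i, ((r i)%:E < f i (submxcol y i))%E by [].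
apply: (@filter_forall _ _
  (fun i y => is_true ((r i)%:E < f i (submxcol y i))%E) (nbhs x)) => i.
have [V Vx VP] := lf i _ _ (rf i).
have cts : submxcol y i @[y --> x] --> submxcol x i.
  apply: (@cvg_entries _ _ _ _ (nbhs_filter x)) => k; rewrite mxE.
  have -> : (fun y : 'cV[R]_(\sum_(i < s) n i) => submxcol y i k 0) =
      (fun y => y (tagnat.Rank i k) 0).
    by apply/funext => y; rewrite mxE.
  exact: coord_continuous.
have nearV : \forall y \near x, V (submxcol y i) by exact: cts.
by apply: filterS nearV => y; exact: VP.
Qed.

Lemma subgradient_sepsum (R : realType) s (n : 'I_s -> nat)
    (f : forall i, 'cV[R]_(n i) -> \bar R) (x g : 'cV[R]_(\sum_(i < s) n i)) :
  (forall i, subgradient (f i) (submxcol x i) (submxcol g i)) ->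
  subgradient (sepsum f) x g.
Proof.
move=> fg z; rewrite dot_submxcol -sumEFin -big_split/=.
by apply: lee_sum => i _; rewrite submxcolB; exact: fg.
Qed.

Definition strict_upper_gram (R : realType) (s m : nat) (n : 'I_s -> nat)
    (A : forall i, 'M[R]_(m, n i)) : 'M[R]_(\sum_(i < s) n i) :=
  \mxblock_(i < s, j < s) (if (i < j)%N then (A i)^T *m A j else 0).

Lemma submxcol_strict_upper_gram (R : realType) (s m : nat) (n : 'I_s -> nat)
    (A : forall i, 'M[R]_(m, n i)) (u : 'cV[R]_(\sum_(i < s) n i)) j :
  submxcol (strict_upper_gram A *m u) j
    = (A j)^T *m \sum_(i < s | (j < i)%N) A i *m submxcol u i.
Proof.
rewrite -{1}[u]submxcolK mul_mxblock_mxrow mxcolK mulmx_sumr [RHS]big_mkcond/=.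
by apply: eq_bigr => i _; case: ifP => _; rewrite ?mul0mx ?mulmxA.
Qed.

(** The zero blocks that border U in Mtilde2 leave the bound for U unchanged: it
    is the bound for Mtilde2 at vectors supported on the first blocks. *)
Lemma dot_strict_upper_gram_le (R : realType) (s m : nat) (n : 'I_s -> nat)
    (A : forall i, 'M[R]_(m, n i)) (hm : (0 < m)%N) u v :
  `|dot u (strict_upper_gram A *m v)|
    <= mxnorm2 (Mtilde2 A) / 2 * (dot u u + dot v v).
Proof.
have [L0 hL] : 0 <= mxnorm2 (Mtilde2 A) /\ _ :=
  mxnorm2_operator_bound (Mtilde2 A) (ltn_addl _ hm).
apply: dot_mulmx_le => // w.
have dcol (a c : 'cV[R]_(\sum_(i < s) n i)) :
    dot (col_mx a 0 : 'cV[R]_(_ + m)) (col_mx c 0) = dot a c.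
  by rewrite !dotE tr_col_mx mul_row_col mulmx0 addr0.
have := hL (col_mx w 0).
by rewrite /Mtilde2 mul_block_col !mulmx0 !mul0mx !addr0 !dcol.
Qed.

Definition stepsize_mx (R : realType) (s : nat) (n : 'I_s -> nat)
    (alpha : 'I_s -> R) : 'M[R]_(\sum_(i < s) n i) :=
  \mxdiag_(i < s) (alpha i)^-1%:M.

Lemma submxcol_stepsize_mx (R : realType) (s : nat) (n : 'I_s -> nat)
    (alpha : 'I_s -> R) (u : 'cV[R]_(\sum_(i < s) n i)) j :
  submxcol (stepsize_mx n alpha *m u) j = (alpha j)^-1 *: submxcol u j.
Proof. by rewrite -{1}[u]submxcolK mul_mxdiag_mxcol mxcolK mul_scalar_mx. Qed.

Lemma tr_stepsize_mx (R : realType) (s : nat) (n : 'I_s -> nat)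
    (alpha : 'I_s -> R) : (stepsize_mx n alpha)^T = stepsize_mx n alpha.
Proof.
by rewrite tr_mxdiag; apply: eq_mxdiag => i; rewrite tr_scalar_mx.
Qed.

Lemma stepsize_mx_ge (R : realType) (s : nat) (n : 'I_s -> nat)
    (alpha : 'I_s -> R) c (u : 'cV[R]_(\sum_(i < s) n i)) :
  (forall i, c <= (alpha i)^-1) ->
  c * dot u u <= dot u (stepsize_mx n alpha *m u).
Proof.
move=> hc; rewrite !dot_submxcol mulr_sumr; apply: ler_sum => i _.
by rewrite submxcol_stepsize_mx dotZr ler_wpM2r ?dot_ge0.
Qed.

(** Written around the new block submxcol xn j, so that the value of the affine
    part at the minimiser is the new residual minus the blocks i > j that the
    sweep has not updated yet. *)
Lemma subobjE (R : realType) (s m : nat) (n : 'I_s -> nat)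
    (f : forall i, 'cV[R]_(n i) -> \bar R) (A : forall i, 'M[R]_(m, n i))
    (b : 'cV[R]_m) beta (alpha : 'I_s -> R)
    (xk xt xn : 'cV[R]_(\sum_(i < s) n i)) (y : 'cV[R]_m) j v :
  let r := A j *m (v - submxcol xn j) + (residual A b xn
    - \sum_(i < s | (j < i)%N) A i *m submxcol (xn - xt) i) in
  subobj f A b beta alpha xk xt xn y v =
  (f j v + (beta / 2 * dot r r + dot y r
    + beta / (2 * alpha j) * dot (v - submxcol xk j) (v - submxcol xk j))%:E)%E.
Proof.
move=> r; have spliceE i : i != j -> submxcol (splice xn xt v) i
    = submxcol (if (i < j)%N then xn else xt) i.
  by move=> ij; rewrite mxcolK dfwithout 1?eq_sym//; case: ifP.
have splicej : submxcol (splice xn xt v) j = v by rewrite mxcolK dfwithin.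
have rE : r = residual A b (splice xn xt v).
  rewrite /r /residual mulmxBr [X in _ + (_ - X)]big_mkcond/=.
  rewrite [X in _ + (X - _ - _)](bigD1 j)//= [X in _ + (_ - X)](bigD1 j)//=.
  rewrite ltnn add0r.
  rewrite [in RHS](bigD1 j)//= splicej.
  have -> : \sum_(i < s | i != j) A i *m submxcol (splice xn xt v) i =
      \sum_(i < s | i != j) A i *m submxcol xn i -
      \sum_(i < s | i != j)
        (if (j < i)%N then A i *m submxcol (xn - xt) i else 0).
    rewrite -sumrB; apply: eq_bigr => i ij; rewrite spliceE//.
    have [ij'|ji|/val_inj ji] := ltngtP i j; last by rewrite ji eqxx in ij.
    - by rewrite subr0.
    - by rewrite submxcolB mulmxBr subKr.
  by rewrite !addrA subrK addrAC.
rewrite /subobj /auglag -rE !norm2_sqr -addeA -EFinD; congr (_ + _)%E.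
rewrite /sepsum (bigD1 j)//= {1}/only eqxx splicej big1 ?adde0// => i ij.
by rewrite /only (negbTE ij).
Qed.

(** In the optimality condition of block j, beta times the new residual is
    absorbed by the dual update, which turns y into y', and the blocks i > j
    give row j of the strictly upper triangular matrix. *)
Lemma subgradient_of_subobj (R : realType) (s m : nat) (n : 'I_s -> nat)
    (f : forall i, 'cV[R]_(n i) -> \bar R) (A : forall i, 'M[R]_(m, n i))
    (b : 'cV[R]_m) beta (alpha : 'I_s -> R)
    (xk xt xn : 'cV[R]_(\sum_(i < s) n i)) (y y' : 'cV[R]_m) j :
  alpha j != 0 ->
  Defs.proper (f j) -> econvex (f j) ->
  y' = y + beta *: residual A b xn ->
  argmin setT (subobj f A b beta alpha xk xt xn y (j := j)) (submxcol xn j) ->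
  subgradient (f j) (submxcol xn j)
    (submxcol (beta *: (strict_upper_gram A *m (xn - xt)
        - stepsize_mx n alpha *m (xn - xk)) - (\mxrow_(i < s) A i)^T *m y') j).
Proof.
move=> a0 pf cf y'E [_ xmin].
pose q := residual A b xn
  - \sum_(i < s | (j < i)%N) A i *m submxcol (xn - xt) i.
pose Q v := let r := A j *m (v - submxcol xn j) + q in
  beta / 2 * dot r r + dot y r
    + beta / (2 * alpha j) * dot (v - submxcol xk j) (v - submxcol xk j).
pose g := (A j)^T *m (beta *: q + y)
  + (beta / alpha j) *: (submxcol xn j - submxcol xk j).
have -> : submxcol (beta *: (strict_upper_gram A *m (xn - xt)
    - stepsize_mx n alpha *m (xn - xk)) - (\mxrow_(i < s) A i)^T *m y') j = - g.
  rewrite submxcolB submxcolZ submxcolB submxcol_strict_upper_gram.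
  rewrite submxcol_stepsize_mx.
  rewrite tr_mxrow mxcol_mul mxcolK submxcolB y'E /g /q.
  move: (residual A b xn) => T.
  rewrite !mulmxDr -!scalemxAr mulmxDr mulmxN.
  move: (_ *m T) (_ *m \sum_(i < s | _) _) (_ *m y) => {}T S Y.
  by apply/matrixP => k l; rewrite !mxE; ring.
apply: (@subgradient_of_argmin _ _ _ Q _ _
  (fun v => beta / 2 * dot (A j *m v) (A j *m v)
    + beta / (2 * alpha j) * dot v v)) => //.
- move=> v t; rewrite /Q /g.
  rewrite subrr mulmx0 add0r ![submxcol xn j + t *: v - _]addrAC subrr add0r.
  rewrite -scalemxAr [dot (_ + _) v]dotDl -dot_mulmx.
  move: (q) (submxcol xn j - submxcol xk j) (A j *m v) => q' e w.
  rewrite !(dotDl, dotDr, dotZl, dotZr) (dotC w q') (dotC v e).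
  by field.
- by move=> v; have := xmin v I; rewrite !subobjE.
Qed.

(** * The convergence theorem *)

Unset Implicit Arguments.

Theorem theorem6p3 (R : realType) (s m : nat) (n : 'I_s -> nat)
    (hs : (0 < s)%N) (hm : (0 < m)%N) (hn : forall i, (0 < n i)%N)
    (f : forall i, 'cV[R]_(n i) -> \bar R)
    (hf : forall i, Gamma0 R (n i) (f i))
    (A : forall i, 'M[R]_(m, n i)) (b : 'cV[R]_m)
    (alpha : 'I_s -> R) (beta : R) (hbeta : 0 < beta)
    (hsol : solutions f A b !=set0)
    (hri : [set \mxrow_(i < s) A i *m x | x in relint (edom (sepsum f))] b)
    (x : nat -> 'cV[R]_(\sum_(i < s) n i)) (y : nat -> 'cV[R]_m)
    (hxy : generated f A b beta alpha x y)
    (halpha : forall i, 0 < alpha i)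
    (hbound : forall i,
      ((alpha i)%:E < (2 * mxnorm2 (Mtilde2 A))%:E^-1)%E) :
  exists2 xs, solutions f A b xs & x k @[k --> \oo] --> xs.
Proof.
have fNy i v : f i v <> -oo%E by have [[]] := hf i.
have FNy := sepsum_Ny fNy.
have [xs [/= Axs xsmin]] := hsol; have [x0 rx0 Ax0] := hri.
have pF : Defs.proper (sepsum f).
  split; first exact: FNy.
  by exists x0 => Fx0; have := rx0.1; rewrite /edom/= Fx0.
have [||||||ys Fxs] := @lagrange_multiplier R _ _ (sepsum f)
  (\mxrow_(i < s) A i) b x0 xs.
- by apply: econvex_sepsum => // i; have [] := hf i.
- exact: FNy.
- exact: rx0.
- exact: Ax0.
- by rewrite mulmx_mxrow.
- by move=> z; rewrite mulmx_mxrow; exact: xsmin.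
have [L0 _] := mxnorm2_operator_bound (Mtilde2 A) (ltn_addl _ hm).
set L := mxnorm2 (Mtilde2 A) in hbound L0.
have La i : 2 * L < (alpha i)^-1.
  have := hbound i; rewrite inver; case: eqP => [-> _|/eqP Lneq].
    by rewrite invr_gt0.
  have L2 : 0 < 2 * L by rewrite lt_def Lneq mulr_ge0.
  by rewrite lte_fin => ?; rewrite -[ltLHS]invrK ltf_pV2 ?posrE ?invr_gt0.
have [c Lc ca] : exists2 c, 2 * L < c & forall i, c <= (alpha i)^-1.
  exists (\big[Num.min/(2 * L + 1)]_i (alpha i)^-1); last first.
    by move=> i; exact: bigmin_le_cond.
  by apply: lt_bigmin => //; rewrite ltrDl.
have [||||||||||||xh [yh [Axh Fxh xxh]]] := @forward_reflected_cvg R _ _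
  (sepsum f) (\mxrow_(i < s) A i) b (stepsize_mx n alpha) (strict_upper_gram A)
  c L beta x y xs ys.
- by apply: lower_semicontinuous_sepsum => // i; have [] := hf i.
- exact: pF.
- exact: hbeta.
- exact: L0.
- exact: Lc.
- exact: tr_stepsize_mx.
- by move=> u; exact: stepsize_mx_ge.
- by move=> u v; exact: dot_strict_upper_gram_le.
- move=> k; apply: subgradient_sepsum => j.
  have [pf _ cf] := hf j; have [/(_ j) xmin yE] := hxy k.+1 isT.
  have := subgradient_of_subobj (lt0r_neq0 (halpha j)) pf cf yE xmin.
  have -> : x k.+2 - (2 *: x k.+1 - x k.+1.-1) =
      x k.+2 - x k.+1 - (x k.+1 - x k).
    rewrite scaler_nat mulr2n /= !opprB opprD.
    by rewrite -[RHS]addrA [- _ + (_ - _)]addrCA.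
  by [].
- by move=> k; have [_] := hxy k.+1 isT; rewrite mulmx_mxrow.
- by rewrite mulmx_mxrow.
- exact: Fxs.
exists xh => //; split; first by rewrite /= -mulmx_mxrow.
move=> z /= Az; have := Fxh z.
rewrite dotNl -dot_mulmx mulmxBr Axh mulmx_mxrow Az subrr.
by rewrite dotC dot0l oppr0 adde0.
Qed.
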